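(* Let $E:\mathbb R^d\to\mathbb R$ be twice continuously differentiable, $F=-\nabla E$, $J=-\nabla^2E$, and suppose Assumption A (stated in the context) holds. Fix $T>0$, $1\le k\le d$, $\beta,\gamma>0$, an initial state $x_0\in\mathbb R^d$ and orthonormal vectors $v_{1,0},\dots,v_{k,0}\in\mathbb R^d$. Let $(x(t),v_1(t),\dots,v_k(t))$, $t\in[0,T]$, be the solution of the high-index saddle dynamics $$\frac{dx}{dt}=\beta\Big(I-2\sum_{j=1}^k v_jv_j^\top\Big)F(x),\qquad \frac{dv_i}{dt}=\gamma\Big(I-v_iv_i^\top-2\sum_{j=1}^{i-1}v_jv_j^\top\Big)J(x)v_i,\quad 1\le i\le k,$$ with $x(0)=x_0$, $v_i(0)=v_{i,0}$. For $N\in\mathbb N$ let $\tau=T/N$, $t_n=n\tau$, and let $x_n$, $v_{i,n}$ be generated by the discrete HiSD scheme given in the context. Then for $\tau$ sufficiently small, $$\|x(t_n)-x_n\|+\sum_{i=1}^k\|v_i(t_n)-v_{i,n}\|\le Q\tau,\qquad 1\le n\le N,$$ where the constant $Q>0$ is independent of $\tau$, $n$ and $N$.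
   Context: $\|\cdot\|$ is the Euclidean ($l^2$) norm of a vector, or the induced norm of a matrix; $I$ is the $d\times d$ identity. Assumption A: there is a constant $L>0$ such that for all $x,x_1,x_2\in\mathbb R^d$, $\|J(x_2)-J(x_1)\|+\|F(x_2)-F(x_1)\|\le L\|x_2-x_1\|$ and $\|F(x)\|\le L(1+\|x\|)$. Discrete HiSD scheme: starting from $x_0$ and orthonormal $\{v_{i,0}\}_{i=1}^k$, for $n=1,\dots,N$, $$x_n=x_{n-1}+\tau\beta\Big(I-2\sum_{j=1}^k v_{j,n-1}v_{j,n-1}^\top\Big)F(x_{n-1}),$$ $$\tilde v_{i,n}=v_{i,n-1}+\tau\gamma J(x_{n-1})v_{i,n-1},\quad 1\le i\le k,$$ and then, successively for $i=1,\dots,k$ (Gram–Schmidt orthonormalization), $$v_{i,n}=\frac1{Y_{i,n}}\Big(\tilde v_{i,n}-\sum_{j=1}^{i-1}(\tilde v_{i,n}^\top v_{j,n})v_{j,n}\Big),\qquad Y_{i,n}=\Big\|\tilde v_{i,n}-\sum_{j=1}^{i-1}(\tilde v_{i,n}^\top v_{j,n})v_{j,n}\Big\|$$ (for $\tau$ sufficiently small $Y_{i,n}\neq0$). ''$\tau$ sufficiently small'' means $\tau\le\tau_0$ for some $\tau_0>0$ independent of $n$ and $N$. Constants may depend on $E$, $L$, $d$, $k$, $\beta$, $\gamma$, $T$ and the initial data. *)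

(* Defs.v *)
From mathcomp Require Import all_boot all_order all_algebra.
From mathcomp Require Import all_classical all_reals all_analysis.
Import numFieldNormedType.Exports.
Import Order.TTheory GRing.Theory Num.Theory.

Set Implicit Arguments.
Unset Strict Implicit.
Unset Printing Implicit Defensive.

Local Open Scope classical_set_scope.
Local Open Scope ring_scope.

(* The norm that the library puts on matrices is the maximum norm; it has the
   same topology as the norms below, hence the same derivatives. *)

Definition dot (R : realType) (d : nat) (u v : 'cV[R]_d) : R :=
  (u^T *m v) 0 0.

Definition enorm (R : realType) (d : nat) (u : 'cV[R]_d) : R :=
  Num.sqrt (dot u u).

Definition opnorm (R : realType) (d : nat) (A : 'M[R]_d) : R :=
  sup [set enorm (A *m u) | u in [set u : 'cV[R]_d | enorm u <= 1]].

Definition orthonormal_family (R : realType) (d k : nat)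
    (v : 'I_k -> 'cV[R]_d) : Prop :=
  forall i j, dot (v i) (v j) = (i == j)%:R.

Definition grad (R : realType) (d : nat) (E : 'cV[R]_d -> R) (x : 'cV[R]_d) :
    'cV[R]_d :=
  \col_i 'D_(delta_mx i 0) E x.

Definition hessian (R : realType) (d : nat) (E : 'cV[R]_d -> R)
    (x : 'cV[R]_d) : 'M[R]_d :=
  \matrix_(i, j) 'D_(delta_mx j 0) (fun y => grad E y i 0) x.

Definition twice_continuously_differentiable (R : realType) (d : nat)
    (E : 'cV[R]_d -> R) : Prop :=
  [/\ forall x : 'cV[R]_d, differentiable E x,
      forall x : 'cV[R]_d, differentiable (grad E) x
    & continuous (hessian E)].

Definition lipschitz_linear_growth (R : realType) (d : nat) (L : R)
    (F : 'cV[R]_d -> 'cV[R]_d) (J : 'cV[R]_d -> 'M[R]_d) : Prop :=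
  (forall x1 x2, opnorm (J x2 - J x1) + enorm (F x2 - F x1)
                   <= L * enorm (x2 - x1)) /\
  (forall x, enorm (F x) <= L * (1 + enorm x)).

(* The derivative of f at t along A is l; for A = [0, T] it is one-sided at
   the endpoints, so values of f outside [0, T] are irrelevant. *)
Definition has_derivative_within (R : realType) (d : nat) (A : set R)
    (f : R -> 'cV[R]_d) (t : R) (l : 'cV[R]_d) : Prop :=
  (s - t)^-1 *: (f s - f t) @[s --> within A t^'] --> l.

Definition HiSD_solution (R : realType) (d k : nat)
    (F : 'cV[R]_d -> 'cV[R]_d) (J : 'cV[R]_d -> 'M[R]_d) (T beta gamma : R)
    (x0 : 'cV[R]_d) (v0 : 'I_k -> 'cV[R]_d)
    (x : R -> 'cV[R]_d) (v : 'I_k -> R -> 'cV[R]_d) : Prop :=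
  [/\ x 0 = x0,
      forall i, v i 0 = v0 i,
      forall t : R, 0 <= t <= T ->
        has_derivative_within `[0, T] x t
          (beta *: ((1%:M - 2 *: \sum_(j < k) (v j t *m (v j t)^T))
                      *m F (x t)))
    & forall (t : R) (i : 'I_k), 0 <= t <= T ->
        has_derivative_within `[0, T] (v i) t
          (gamma *: ((1%:M - v i t *m (v i t)^T
                      - 2 *: \sum_(j < k | (j < i)%N) (v j t *m (v j t)^T))
                       *m J (x t) *m v i t))].

(* Unnormalized i-th Gram-Schmidt vector: w minus its components along the
   v j with j < i. *)
Definition gram_schmidt_residual (R : realType) (d k : nat)
    (v : 'I_k -> 'cV[R]_d) (i : 'I_k) (w : 'cV[R]_d) : 'cV[R]_d :=
  w - \sum_(j < k | (j < i)%N) dot w (v j) *: v j.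

(* Since 0^-1 = 0, a zero residual y would give v n.+1 i = 0, so the scheme
   always determines its iterates uniquely, and an iterate v n.+1 i close to a
   unit vector has a nonzero normalization factor enorm y. *)
Definition HiSD_scheme (R : realType) (d k : nat)
    (F : 'cV[R]_d -> 'cV[R]_d) (J : 'cV[R]_d -> 'M[R]_d) (tau beta gamma : R)
    (N : nat) (x0 : 'cV[R]_d) (v0 : 'I_k -> 'cV[R]_d)
    (x : nat -> 'cV[R]_d) (v : nat -> 'I_k -> 'cV[R]_d) : Prop :=
  [/\ x 0%N = x0,
      forall i, v 0%N i = v0 i,
      forall n, (n < N)%N ->
        x n.+1 = x n + (tau * beta) *:
          ((1%:M - 2 *: \sum_(j < k) (v n j *m (v n j)^T)) *m F (x n))
    & forall n (i : 'I_k), (n < N)%N ->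
        let w := v n i + (tau * gamma) *: (J (x n) *m v n i) in
        let y := gram_schmidt_residual (v n.+1) i w in
        v n.+1 i = (enorm y)^-1 *: y].

(* Main.v *)
Require Import Defs.
From mathcomp Require Import all_boot all_order all_algebra.
From mathcomp Require Import all_classical all_reals all_analysis.
From mathcomp Require Import ring lra.
Import numFieldNormedType.Exports.
Import Order.TTheory GRing.Theory Num.Theory.

Set Implicit Arguments.
Unset Strict Implicit.
Unset Printing Implicit Defensive.

Local Open Scope classical_set_scope.
Local Open Scope ring_scope.

(** Write z = (x, v_1, ..., v_k) for a state and Phi for the right-hand side of
    the dynamics.  The scheme is a perturbation of size O(tau^2) per step of the
    explicit Euler method for z' = Phi(z), so the theorem is an instance of the
    principle that consistency plus stability gives convergence.

    Consistency of the scheme is the delicate half, because Gram-Schmidt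
    subtracts components along the new vectors v_{j,n}, j < i, while Phi only
    mentions the old ones.  If v_{j,n} = v_j + tau Phi_j + O(tau^2) is already
    known for j < i and the old vectors are orthonormal, the coefficient of
    v_{j,n} in the i-th Gram-Schmidt sum is
      tau gamma (v_j . J v_i + v_i . J v_j) + O(tau^2).
    When J is symmetric this is 2 tau gamma v_j . J v_i, which is where the
    factor 2 of the dynamics comes from; the normalization then removes the
    component along v_i.  This is gram_schmidt_expansion, an induction on i.  The
    symmetry of J is Schwarz's theorem for second derivatives, hessian_sym.

    The expansion may be used at every step: Gram-Schmidt output is exactly
    orthonormal when no residual vanishes, which the expansion itself
    guarantees for small tau, and the positions stay in a fixed ball by linear
    growth of F and the discrete Gronwall inequality (scheme_invariant).

    On the continuous side, the solution is continuous on [0, T], hence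
    bounded; Phi is bounded on balls, so the solution is Lipschitz; Phi is
    Lipschitz on balls, so by the mean value theorem
    z(t + tau) = z(t) + tau Phi(z(t)) + O(tau^2) (solution_consistent).

    With e_n the distance between z(n tau) and the n-th iterate, the two
    expansions and the Lipschitz bound give
    e_{n+1} <= (1 + K tau) e_n + K' tau^2 with e_0 = 0, hence e_n = O(tau) by
    Gronwall (euler_convergence).

    All estimates use the maximum norm, for which the scalar mean value theorem
    can be applied entry by entry; the Euclidean norm is comparable to it and
    enters through the normalization in Gram-Schmidt and in the final bound. *)

(** * Norms and inner products *)

Section MatrixNorms.
Context {R : realType}.

Lemma entry_le_norm m n (A : 'M[R]_(m, n)) i j : `|A i j| <= `|A|.
Proof.
rewrite [leRHS]/Num.norm /= mx_normrE.
exact: (le_bigmax _ (fun ij => `|A ij.1 ij.2|) (i, j)).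
Qed.

Lemma entry_dist_le m n (A B : 'M[R]_(m, n)) i j :
  `|A i j - B i j| <= `|A - B|.
Proof. by have := entry_le_norm (A - B) i j; rewrite !mxE. Qed.

Lemma norm_le_entries m n (A : 'M[R]_(m, n)) c :
  0 <= c -> (forall i j, `|A i j| <= c) -> `|A| <= c.
Proof.
by move=> c0 Ac; rewrite [leLHS]/Num.norm /= mx_normrE bigmax_le.
Qed.

Lemma norm_trmx_le m n (A : 'M[R]_(m, n)) : `|A^T| <= `|A|.
Proof.
by apply: norm_le_entries => // i j; rewrite mxE entry_le_norm.
Qed.

Lemma norm_mulmx m n p (A : 'M[R]_(m, n)) (B : 'M[R]_(n, p)) :
  `|A *m B| <= n%:R * `|A| * `|B|.
Proof.
apply: norm_le_entries => [|i j]; first by rewrite !mulr_ge0.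
rewrite mxE (le_trans (ler_norm_sum _ _ _)) //.
rewrite -mulrA mulr_natl.
rewrite -[X in _ *+ X]card_ord -sumr_const ler_sum // => l _.
by rewrite normrM ler_pM // entry_le_norm.
Qed.

Variable d : nat.
Implicit Types u v w : 'cV[R]_d.

Lemma dotE u v : dot u v = \sum_i u i 0 * v i 0.
Proof. by rewrite /dot mxE; apply: eq_bigr => i _; rewrite mxE. Qed.

Lemma dotC u v : dot u v = dot v u.
Proof. by rewrite !dotE; apply: eq_bigr => i _; rewrite mulrC. Qed.

Lemma dotDr u v w : dot u (v + w) = dot u v + dot u w.
Proof. by rewrite /dot mulmxDr mxE. Qed.

Lemma dotNr u v : dot u (- v) = - dot u v.
Proof. by rewrite /dot mulmxN mxE. Qed.

Lemma dotBr u v w : dot u (v - w) = dot u v - dot u w.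
Proof. by rewrite dotDr dotNr. Qed.

Lemma dotZr a u v : dot u (a *: v) = a * dot u v.
Proof. by rewrite /dot -scalemxAr mxE. Qed.

Lemma dotDl u v w : dot (u + v) w = dot u w + dot v w.
Proof. by rewrite dotC dotDr !(dotC w). Qed.

Lemma dotBl u v w : dot (u - v) w = dot u w - dot v w.
Proof. by rewrite dotC dotBr !(dotC w). Qed.

Lemma dotZl a u v : dot (a *: u) v = a * dot u v.
Proof. by rewrite dotC dotZr dotC. Qed.

Lemma dot_sumr I (r : seq I) (P : pred I) u (f : I -> 'cV[R]_d) :
  dot u (\sum_(i <- r | P i) f i) = \sum_(i <- r | P i) dot u (f i).
Proof.
by rewrite /dot mulmx_sumr summxE.
Qed.

Lemma dot_sym_mx (A : 'M[R]_d) u v : A^T = A -> dot u (A *m v) = dot v (A *m u).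
Proof.
by move=> sA; rewrite dotC /dot trmx_mul sA mulmxA.
Qed.

Lemma outer_mulmx u v w : u *m v^T *m w = dot v w *: u.
Proof.
by rewrite -mulmxA [v^T *m w]mx11_scalar mul_mx_scalar.
Qed.

Lemma norm_dot u v : `|dot u v| <= d%:R * `|u| * `|v|.
Proof.
rewrite (le_trans (entry_le_norm _ 0 0)) // (le_trans (norm_mulmx _ _)) //.
by rewrite ler_wpM2r // ler_wpM2l // norm_trmx_le.
Qed.

Lemma dot_ge0 u : 0 <= dot u u.
Proof. by rewrite dotE sumr_ge0 // => i _; rewrite -expr2 sqr_ge0. Qed.

Lemma enorm_ge0 u : 0 <= enorm u.
Proof. exact: sqrtr_ge0. Qed.

Lemma sqr_enorm u : enorm u ^+ 2 = dot u u.
Proof. by rewrite sqr_sqrtr // dot_ge0. Qed.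

Lemma norm_le_enorm u : `|u| <= enorm u.
Proof.
apply: norm_le_entries => [|i j]; first exact: enorm_ge0.
rewrite ord1 -sqrtr_sqr ler_wsqrtr // dotE (bigD1 i) //= expr2 lerDl.
by rewrite sumr_ge0 // => l _; rewrite -expr2 sqr_ge0.
Qed.

Lemma enorm_le_norm u : enorm u <= d%:R * `|u|.
Proof.
rewrite -(ger0_norm (_ : 0 <= d%:R * `|u|)) ?mulr_ge0 // -sqrtr_sqr.
rewrite ler_wsqrtr // (le_trans (ler_norm _)) // (le_trans (norm_dot u u)) //.
rewrite exprMn -mulrA -expr2 ler_wpM2r ?sqr_ge0 // -natrX ler_nat.
by rewrite expnS expn1; case: (d) => // e; rewrite leq_pmull.
Qed.

(** An entry of A is an entry of the image of a basis vector, which has Euclidean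
    norm 1.  The set under the supremum is bounded because the maximum norm
    controls the images of the unit ball. *)
Lemma norm_le_opnorm (A : 'M[R]_d) : `|A| <= opnorm A.
Proof.
have ub : has_ubound [set enorm (A *m u) | u in [set u : 'cV[R]_d | enorm u <= 1]].
  exists (d%:R * (d%:R * `|A| * 1)) => _ [u /= u1 <-].
  rewrite (le_trans (enorm_le_norm _)) // ler_wpM2l //.
  rewrite (le_trans (norm_mulmx _ _)) // ler_wpM2l ?mulr_ge0 //.
  exact: le_trans (norm_le_enorm u) u1.
have le_op (u : 'cV[R]_d) : enorm u <= 1 -> enorm (A *m u) <= opnorm A.
  by move=> u1; apply: ub_le_sup => //; exists u.
apply: norm_le_entries => [|i j].
  apply: le_trans (le_op 0 _); first exact: enorm_ge0.
  by rewrite /enorm /dot mulmx0 mxE sqrtr0.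
apply: le_trans (le_op (delta_mx j 0) _); last first.
  rewrite /enorm dotE (bigD1 j) //= big1 ?addr0 => [|l lj].
    by rewrite !mxE !eqxx mulr1 sqrtr1.
  by rewrite mxE (negbTE lj) mul0r.
have -> : A i j = (A *m (delta_mx j 0 : 'cV[R]_d)) i 0 by rewrite -colE mxE.
exact: le_trans (entry_le_norm _ i 0) (norm_le_enorm _).
Qed.

End MatrixNorms.

(** * Bounded Lipschitz maps and the vector fields of the dynamics *)

Section BoundedLipschitz.
Context {R : realType} {Z : Type} (D : Z -> Prop) (dist : Z -> Z -> R).
Hypothesis dist_ge0 : forall z w, 0 <= dist z w.

(** Boundedness is bundled with the Lipschitz condition so that the class is
    closed under products; the vector fields of the dynamics are polynomials in
    the v_i, F(x) and J(x), so they belong to it on every ball. *)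
Definition bounded_lipschitz (V : normedModType R) (f : Z -> V) :=
  exists C, forall z w, D z -> D w ->
    `|f z| <= C /\ `|f z - f w| <= C * dist z w.

Lemma bounded_lipschitz_cst (V : normedModType R) (a : V) :
  bounded_lipschitz (fun=> a).
Proof.
exists `|a| => z w _ _; split=> //.
by rewrite subrr normr0 mulr_ge0.
Qed.

Lemma bounded_lipschitzD (V : normedModType R) (f g : Z -> V) :
  bounded_lipschitz f -> bounded_lipschitz g ->
  bounded_lipschitz (fun z => f z + g z).
Proof.
move=> [A fA] [B gB]; exists (A + B) => z w Dz Dw.
have [[fz fzw] [gz gzw]] := (fA z w Dz Dw, gB z w Dz Dw).
split; first by rewrite (le_trans (ler_normD _ _)) // lerD.
by rewrite opprD addrACA mulrDl (le_trans (ler_normD _ _)) // lerD.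
Qed.

(** The constant comes from
    b (f z) (g z) - b (f w) (g w) = b (f z - f w) (g z) + b (f w) (g z - g w). *)
Lemma bounded_lipschitz_bilinear (U V W : normedModType R)
    (b : U -> V -> W) (K : R) (f : Z -> U) (g : Z -> V) :
  0 <= K ->
  (forall u v, `|b u v| <= K * `|u| * `|v|) ->
  (forall u u' v, b (u - u') v = b u v - b u' v) ->
  (forall u v v', b u (v - v') = b u v - b u v') ->
  bounded_lipschitz f -> bounded_lipschitz g ->
  bounded_lipschitz (fun z => b (f z) (g z)).
Proof.
move=> K0 bK bBl bBr [A fA] [B gB]; exists (2 * (K * A * B)) => z w Dz Dw.
have [[fz fzw] [gz gzw]] := (fA z w Dz Dw, gB z w Dz Dw).
have [fw gw] := ((fA w z Dw Dz).1, (gB w z Dw Dz).1).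
have A0 : 0 <= A := le_trans (normr_ge0 _) fz.
have B0 : 0 <= B := le_trans (normr_ge0 _) gz.
split.
  rewrite (le_trans (bK _ _)) // (@le_trans _ _ (K * A * B)) //.
    by rewrite ler_pM ?mulr_ge0 // ler_wpM2l.
  by rewrite ler_peMl ?mulr_ge0 // ler1n.
have -> : b (f z) (g z) - b (f w) (g w)
  = b (f z - f w) (g z) + b (f w) (g z - g w).
  by rewrite bBl bBr addrA subrK.
rewrite (le_trans (ler_normD _ _)) //.
have -> : 2 * (K * A * B) * dist z w
  = K * (A * dist z w) * B + K * A * (B * dist z w) by ring.
by apply: lerD; rewrite (le_trans (bK _ _)) // ler_pM ?mulr_ge0 // ler_wpM2l.
Qed.

Lemma bounded_lipschitzZ (V : normedModType R) (a : R) (f : Z -> V) :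
  bounded_lipschitz f -> bounded_lipschitz (fun z => a *: f z).
Proof.
move=> [A fA]; exists (`|a| * A) => z w Dz Dw.
have [fz fzw] := fA z w Dz Dw.
by rewrite -scalerBr !normrZ -mulrA; split; rewrite ler_wpM2l.
Qed.

Lemma bounded_lipschitzB (V : normedModType R) (f g : Z -> V) :
  bounded_lipschitz f -> bounded_lipschitz g ->
  bounded_lipschitz (fun z => f z - g z).
Proof.
move=> hf /(bounded_lipschitzZ (-1)) hg.
have := bounded_lipschitzD hf hg.
by under eq_fun do rewrite scaleN1r.
Qed.

Lemma bounded_lipschitz_sum (V : normedModType R) (I : finType) (P : pred I)
    (f : I -> Z -> V) :
  (forall i, bounded_lipschitz (f i)) ->
  bounded_lipschitz (fun z => \sum_(i | P i) f i z).
Proof.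
move=> hf; elim: (index_enum I) => [|i r IH].
  by under eq_fun do rewrite big_nil; exact: bounded_lipschitz_cst.
under eq_fun do rewrite big_cons.
by case: (P i) => //; apply: bounded_lipschitzD.
Qed.

Lemma bounded_lipschitz_mulmx m n p (f : Z -> 'M[R]_(m, n))
    (g : Z -> 'M[R]_(n, p)) :
  bounded_lipschitz f -> bounded_lipschitz g ->
  bounded_lipschitz (fun z => f z *m g z).
Proof.
apply: (@bounded_lipschitz_bilinear _ _ _ (@mulmx R m n p) n%:R) => //.
- by move=> u v; exact: norm_mulmx.
- by move=> u u' v; rewrite mulmxBl.
- by move=> u v v'; rewrite mulmxBr.
Qed.

Lemma bounded_lipschitz_tr m n (f : Z -> 'M[R]_(m, n)) :
  bounded_lipschitz f -> bounded_lipschitz (fun z => (f z)^T).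
Proof.
move=> [A fA]; exists A => z w Dz Dw; have [fz fzw] := fA z w Dz Dw.
by rewrite -raddfB !(le_trans (norm_trmx_le _)).
Qed.

End BoundedLipschitz.

Section HiSDFields.
Context {R : realType} (d k : nat).

Definition state : Type := ('cV[R]_d * ('I_k -> 'cV[R]_d))%type.
Implicit Types z w : state.

Definition state_dist z w : R :=
  `|z.1 - w.1| + \sum_i `|z.2 i - w.2 i|.

Definition in_ball (M : R) z := `|z.1| <= M /\ forall i, `|z.2 i| <= M.

Variables (F : 'cV[R]_d -> 'cV[R]_d) (J : 'cV[R]_d -> 'M[R]_d).
Variables beta gamma : R.

Definition position_field z : 'cV[R]_d :=
  beta *: ((1%:M - 2 *: \sum_(j < k) (z.2 j *m (z.2 j)^T)) *m F z.1).

Definition direction_field (i : 'I_k) z : 'cV[R]_d :=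
  gamma *: ((1%:M - z.2 i *m (z.2 i)^T
              - 2 *: \sum_(j < k | (j < i)%N) (z.2 j *m (z.2 j)^T))
             *m J z.1 *m z.2 i).

Lemma state_dist_ge0 z w : 0 <= state_dist z w.
Proof. by rewrite addr_ge0 // sumr_ge0. Qed.

Lemma state_distC z w : state_dist z w = state_dist w z.
Proof.
rewrite /state_dist distrC; congr (_ + _).
by apply: eq_bigr => i _; rewrite distrC.
Qed.

Lemma dist_position_le z w : `|z.1 - w.1| <= state_dist z w.
Proof. by rewrite lerDl sumr_ge0. Qed.

Lemma dist_direction_le i z w : `|z.2 i - w.2 i| <= state_dist z w.
Proof.
rewrite /state_dist (bigD1 i) //= addrCA lerDl addr_ge0 // sumr_ge0 //.
Qed.

Variables LF LJ : R.
Hypothesis lipF : forall x y, `|F x - F y| <= LF * `|x - y|.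
Hypothesis lipJ : forall x y, `|J x - J y| <= LJ * `|x - y|.
Variable M : R.

Local Notation bl := (bounded_lipschitz (in_ball M) state_dist).

(** A globally Lipschitz map is bounded on a ball by its value at 0. *)
Lemma position_map_bounded_lipschitz (V : normedModType R) (G : 'cV[R]_d -> V) (LG : R) :
  (forall x y, `|G x - G y| <= LG * `|x - y|) -> bl (fun z => G z.1).
Proof.
move=> lipG; exists (`|G 0| + `|LG| * (1 + M)) => z w [zM _] [wM _].
have M0 : 0 <= M := le_trans (normr_ge0 _) zM.
have lipG' x y : `|G x - G y| <= `|LG| * `|x - y|.
  by rewrite (le_trans (lipG x y)) // ler_wpM2r // ler_norm.
split.
  rewrite -[G z.1](subrK (G 0)) addrC (le_trans (ler_normD _ _)) // lerD2l.
  rewrite (le_trans (lipG' _ _)) // subr0 ler_wpM2l //.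
  by rewrite (le_trans zM) // lerDr.
rewrite (le_trans (lipG' _ _)) // (@le_trans _ _ (`|LG| * state_dist z w)) //.
  by rewrite ler_wpM2l // dist_position_le.
rewrite ler_wpM2r ?state_dist_ge0 //.
by rewrite mulrDr mulr1 addrCA lerDl addr_ge0 // mulr_ge0.
Qed.

Lemma direction_bounded_lipschitz i : bl (fun z => z.2 i).
Proof.
exists (1 + M) => z w [_ zM] [_ wM]; have M0 := le_trans (normr_ge0 _) (zM i).
split; first by rewrite (le_trans (zM i)) // lerDr.
rewrite (le_trans (dist_direction_le i z w)) // ler_peMl ?state_dist_ge0 //.
by rewrite lerDl.
Qed.

Lemma projector_bounded_lipschitz i : bl (fun z => z.2 i *m (z.2 i)^T).
Proof.
by apply: bounded_lipschitz_mulmx; [|apply: bounded_lipschitz_tr];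
  exact: direction_bounded_lipschitz.
Qed.

Lemma position_field_bounded_lipschitz : bl position_field.
Proof.
apply: bounded_lipschitzZ; apply: bounded_lipschitz_mulmx.
  apply: bounded_lipschitzB; first exact/bounded_lipschitz_cst/state_dist_ge0.
  apply: bounded_lipschitzZ; apply: bounded_lipschitz_sum => [|i].
    exact: state_dist_ge0.
  exact: projector_bounded_lipschitz.
exact: position_map_bounded_lipschitz lipF.
Qed.

Lemma direction_field_bounded_lipschitz i : bl (direction_field i).
Proof.
apply: bounded_lipschitzZ; apply: bounded_lipschitz_mulmx.
  2: exact: direction_bounded_lipschitz.
apply: bounded_lipschitz_mulmx; last exact: position_map_bounded_lipschitz lipJ.
apply: bounded_lipschitzB.
  apply: bounded_lipschitzB; last exact: projector_bounded_lipschitz.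
  exact/bounded_lipschitz_cst/state_dist_ge0.
apply: bounded_lipschitzZ; apply: bounded_lipschitz_sum => [|j].
  exact: state_dist_ge0.
exact: projector_bounded_lipschitz.
Qed.

End HiSDFields.

(** * Quantities of order h^n and the Gram-Schmidt step *)

Section BigO.
Context {R : realType} {P : Type}.
Implicit Types (D : P -> Prop) (h : P -> R).

(** Uniform bounds |f p| <= C (h p)^n over a domain D of parameters.  Here a
    parameter is a whole step of the scheme (step size, state, next vectors), so
    that one constant serves all states in a ball and all small steps. *)
Definition isO D h (n : nat) (V : normedModType R) (f : P -> V) :=
  exists C, forall p, D p -> `|f p| <= C * h p ^+ n.

Lemma isO_case D (Q : P -> Prop) h n (V : normedModType R) (f : P -> V) :
  (forall p, D p -> 0 <= h p) ->
  isO (fun p => D p /\ Q p) h n f -> isO (fun p => D p /\ ~ Q p) h n f ->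
  isO D h n f.
Proof.
move=> h0 [A fA] [B fB]; exists (`|A| + `|B|) => p Dp.
have hn : 0 <= h p ^+ n by rewrite exprn_ge0 // h0.
have [Qp|Qp] := pselect (Q p).
  rewrite (le_trans (fA p (conj Dp Qp))) // ler_wpM2r //.
  by rewrite (le_trans (ler_norm A)) // lerDl.
rewrite (le_trans (fB p (conj Dp Qp))) // ler_wpM2r //.
by rewrite (le_trans (ler_norm B)) // lerDr.
Qed.

Lemma isO_subdomain D D' h n (V : normedModType R) (f : P -> V) :
  (forall p, D' p -> D p) -> isO D h n f -> isO D' h n f.
Proof. by move=> sD [A fA]; exists A => p /sD; exact: fA. Qed.

Context (D : P -> Prop) (h : P -> R).
Hypothesis h01 : forall p, D p -> 0 <= h p <= 1.
Local Notation O n f := (isO D h n f).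

Lemma isO_eq n (V : normedModType R) (f g : P -> V) :
  (forall p, D p -> f p = g p) -> O n g -> O n f.
Proof. by move=> fg [A gA]; exists A => p Dp; rewrite fg // gA. Qed.

Lemma isO_bounded (V : normedModType R) (C : R) (f : P -> V) :
  (forall p, D p -> `|f p| <= C) -> O 0 f.
Proof. by move=> fC; exists C => p Dp; rewrite expr0 mulr1 fC. Qed.

Lemma isO_step : O 1 h.
Proof.
by exists 1 => p /h01 /andP[hp _]; rewrite mul1r expr1 ger0_norm.
Qed.

Lemma isO_weaken m n (V : normedModType R) (f : P -> V) :
  (m <= n)%N -> O n f -> O m f.
Proof.
move=> mn [A fA]; exists `|A| => p Dp; have /andP[hp0 hp1] := h01 Dp.
rewrite (le_trans (fA p Dp)) // (@le_trans _ _ (`|A| * h p ^+ n)) //.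
  by rewrite ler_wpM2r ?exprn_ge0 ?ler_norm.
by rewrite ler_wpM2l // ler_wiXn2l.
Qed.

Lemma isOD n (V : normedModType R) (f g : P -> V) :
  O n f -> O n g -> O n (fun p => f p + g p).
Proof.
move=> [A fA] [B gB]; exists (A + B) => p Dp.
by rewrite mulrDl (le_trans (ler_normD _ _)) // lerD ?fA ?gB.
Qed.

Lemma isON n (V : normedModType R) (f : P -> V) : O n f -> O n (fun p => - f p).
Proof. by move=> [A fA]; exists A => p Dp; rewrite normrN fA. Qed.

Lemma isOB n (V : normedModType R) (f g : P -> V) :
  O n f -> O n g -> O n (fun p => f p - g p).
Proof. by move=> hf /isON; exact: isOD. Qed.

Lemma isO_sum n (V : normedModType R) (I : finType) (Q : pred I)
    (f : I -> P -> V) :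
  (forall i, Q i -> O n (f i)) -> O n (fun p => \sum_(i | Q i) f i p).
Proof.
move=> hf; elim: (index_enum I) => [|i r IH].
  by exists 0 => p _; rewrite big_nil normr0 mul0r.
case Qi: (Q i); under eq_fun do rewrite big_cons Qi; last exact: IH.
by apply: isOD => //; exact: hf.
Qed.

Lemma isO_bilinear m n (U V W : normedModType R) (K : R) (b : U -> V -> W)
    (f : P -> U) (g : P -> V) :
  0 <= K -> (forall u v, `|b u v| <= K * `|u| * `|v|) ->
  O m f -> O n g -> O (m + n) (fun p => b (f p) (g p)).
Proof.
move=> K0 bK [A fA] [B gB]; exists (K * A * B) => p Dp.
have -> : K * A * B * h p ^+ (m + n) = K * (A * h p ^+ m) * (B * h p ^+ n).
  by rewrite exprD; ring.
by rewrite (le_trans (bK _ _)) // ler_pM ?mulr_ge0 ?gB // ler_wpM2l // fA.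
Qed.

Lemma isOM m n (f g : P -> R) : O m f -> O n g -> O (m + n) (fun p => f p * g p).
Proof.
move=> Of Og; refine (isO_bilinear (b := fun x y : R => x * y) ler01 _ Of Og).
by move=> u v; rewrite mul1r normrM.
Qed.

Lemma isOZ m n (V : normedModType R) (f : P -> R) (g : P -> V) :
  O m f -> O n g -> O (m + n) (fun p => f p *: g p).
Proof.
move=> Of Og; refine (isO_bilinear (b := fun (x : R) (y : V) => x *: y) ler01 _ Of Og).
by move=> u v; rewrite mul1r normrZ.
Qed.

Lemma isO_cst (V : normedModType R) (a : V) : O 0 (fun=> a).
Proof. exact: isO_bounded. Qed.

Lemma isO_dot m n d (f g : P -> 'cV[R]_d) :
  O m f -> O n g -> O (m + n) (fun p => dot (f p) (g p)).
Proof.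
by apply: (isO_bilinear (K := d%:R) (b := @dot R d)) => // u v; exact: norm_dot.
Qed.

Lemma isO_mulmx m n a b c (f : P -> 'M[R]_(a, b)) (g : P -> 'M[R]_(b, c)) :
  O m f -> O n g -> O (m + n) (fun p => f p *m g p).
Proof.
apply: (isO_bilinear (K := b%:R) (b := @mulmx R a b c)) => // u v.
exact: norm_mulmx.
Qed.

End BigO.

Section UnitVectors.
Context {R : realType} (d : nat).
Implicit Types (u v y : 'cV[R]_d).

Lemma enorm_eq0 y : enorm y = 0 -> y = 0.
Proof.
by move=> y0; apply/eqP; rewrite -normr_le0 -y0 norm_le_enorm.
Qed.

(** This includes y = 0, for which the inverse of the norm is 0: the iterates of
    the scheme are bounded whether or not a residual vanishes. *)
Lemma norm_normalize_le1 y : `|(enorm y)^-1 *: y| <= 1.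
Proof.
have [/enorm_eq0 ->|y0] := eqVneq (enorm y) 0.
  by rewrite scaler0 normr0 ler01.
rewrite normrZ ger0_norm ?invr_ge0 ?enorm_ge0 //.
rewrite mulrC ler_pdivrMr ?mul1r ?norm_le_enorm //.
by rewrite lt_neqAle eq_sym y0 enorm_ge0.
Qed.

Lemma norm_unit_le1 u : dot u u = 1 -> `|u| <= 1.
Proof. by move=> u1; rewrite (le_trans (norm_le_enorm u)) // /enorm u1 sqrtr1. Qed.

Lemma dot_sqr_increment u v :
  dot u u = dot v v + 2 * dot v (u - v) + dot (u - v) (u - v).
Proof. by rewrite !(dotBr, dotBl) [dot u v]dotC; ring. Qed.

(** With u = s^2 - 1 the left-hand side is (s - 1)^2 (s + 2) / (2 s), to be
    compared with u^2 = (s - 1)^2 (s + 1)^2; the ratio is bounded away from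
    s = 0. *)
Lemma inv_sqrt_taylor (s u : R) :
  1 / 2 <= s -> s ^+ 2 = 1 + u -> `|s^-1 - 1 + u / 2| <= 2 * u ^+ 2.
Proof.
move=> s2 su; have s0 : 0 < s by lra.
have -> : u = s ^+ 2 - 1 by rewrite su addrC addKr.
have -> : s^-1 - 1 + (s ^+ 2 - 1) / 2 = (s - 1) ^+ 2 * ((s + 2) * (2 * s)^-1).
  by field; lra.
have -> : 2 * (s ^+ 2 - 1) ^+ 2 = (s - 1) ^+ 2 * (2 * (s + 1) ^+ 2) by ring.
rewrite ger0_norm; last first.
  by rewrite mulr_ge0 ?sqr_ge0 // mulr_ge0 ?invr_ge0; lra.
rewrite ler_wpM2l ?sqr_ge0 // ler_pdivrMr; last lra.
rewrite {su}; nra.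
Qed.

End UnitVectors.

Section GramSchmidtStep.
Context {R : realType} (d k : nat) {P : Type} (D : P -> Prop) (h : P -> R).
Hypothesis h01 : forall p, D p -> 0 <= h p <= 1.
Variables (gamma : R) (v v' : P -> 'I_k -> 'cV[R]_d) (A : P -> 'M[R]_d).
Hypothesis v_orth : forall p, D p -> orthonormal_family (v p).
Hypothesis A_sym : forall p, D p -> (A p)^T = A p.
Hypothesis A_bounded : isO D h 0 A.

Let w i p : 'cV[R]_d := v p i + (h p * gamma) *: (A p *m v p i).
Let y i p := gram_schmidt_residual (v' p) i (w i p).
Hypothesis v'E : forall p i, D p -> v' p i = (enorm (y i p))^-1 *: y i p.

(* psi i is the first-order increment of the residual and phi i that of the
   normalized vector, which loses its component along v i; r i is the
   remainder to be shown to have size h^2. *)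
Let m j i p := dot (v p j) (A p *m v p i).
Let psi (i : 'I_k) p : 'cV[R]_d :=
  gamma *: (A p *m v p i - 2 *: \sum_(j < k | (j < i)%N) m j i p *: v p j).
Let phi i p : 'cV[R]_d := psi i p - (gamma * m i i p) *: v p i.
Let r i p : 'cV[R]_d := v' p i - v p i - h p *: phi i p.

Let v_bounded i : isO D h 0 (fun p => v p i).
Proof.
by apply: (@isO_bounded _ _ _ _ _ 1) => p Dp; rewrite norm_unit_le1 ?v_orth ?eqxx.
Qed.

Let v'_bounded i : isO D h 0 (fun p => v' p i).
Proof.
by apply: (@isO_bounded _ _ _ _ _ 1) => p Dp; rewrite v'E // norm_normalize_le1.
Qed.

Let Av_bounded i : isO D h 0 (fun p => A p *m v p i).
Proof. exact: (isO_mulmx A_bounded (v_bounded i)). Qed.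

Let m_bounded j i : isO D h 0 (m j i).
Proof. exact: (isO_dot (v_bounded j) (Av_bounded i)). Qed.

Let gamma_bounded : isO D h 0 (fun=> gamma). Proof. exact: isO_cst. Qed.

Let psi_bounded i : isO D h 0 (psi i).
Proof.
apply: (isOZ gamma_bounded); apply: isOB => //.
apply: (isOZ (isO_cst D h (2 : R))); apply: isO_sum => j _.
exact: (isOZ (m_bounded j i) (v_bounded j)).
Qed.

Let phi_bounded i : isO D h 0 (phi i).
Proof.
apply: isOB => //; apply: (isOZ (m := 0) _ (v_bounded i)).
exact: (isOM gamma_bounded (m_bounded i i)).
Qed.

Let w_bounded i : isO D h 0 (w i).
Proof.
apply: isOD => //; apply: (isOZ (m := 0) _ (Av_bounded i)).
by apply: (isOM (m := 0) _ gamma_bounded); apply: (isO_weaken h01 (leq0n 1)); exact: isO_step.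
Qed.

Let dot_v0 (i j : 'I_k) p : D p -> (j < i)%N -> dot (v p i) (v p j) = 0.
Proof. by move=> Dp ji; rewrite v_orth // -val_eqE /= gtn_eqF. Qed.

Let dot_psi i p : D p -> dot (v p i) (psi i p) = gamma * m i i p.
Proof.
move=> Dp; rewrite dotZr dotBr dotZr dot_sumr big1 ?mulr0 ?subr0 // => j ji.
by rewrite dotZr dot_v0 ?mulr0.
Qed.

(* The symmetry of A turns v_i . A v_j into v_j . A v_i.  The
   coefficient of v' j in the residual thus receives the same contribution from
   the increment of v j as from that of v i. *)
Let dot_phi (i j : 'I_k) p : D p -> (j < i)%N -> dot (v p i) (phi j p) = gamma * m j i p.
Proof.
move=> Dp ji; rewrite dotBr !dotZr dotBr dotZr dot_sumr big1 => [|l lj].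
  by rewrite dot_v0 // !mulr0 !subr0 /m dot_sym_mx // A_sym.
by rewrite dotZr dot_v0 ?mulr0 // (ltn_trans lj).
Qed.

(* Error of the predicted Gram-Schmidt coefficient 2 h gamma m j i. *)
Let q (i j : 'I_k) p : R := dot (w i p) (v' p j) - 2 * (h p * (gamma * m j i p)).

Let q_small (i j : 'I_k) : (j < i)%N -> isO D h 2 (r j) -> isO D h 2 (q i j).
Proof.
move=> ji rj.
apply: (@isO_eq _ _ _ _ _ _ _ (fun p => dot (w i p) (r j p)
  + h p * h p * (gamma * dot (A p *m v p i) (phi j p)))) => [p Dp|]; last first.
  apply: isOD; first exact: (isO_dot (w_bounded i) rj).
  apply: (isOM (isOM (isO_step h01) (isO_step h01))).
  exact: (isOM gamma_bounded (isO_dot (Av_bounded i) (phi_bounded j))).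
have v'j : v' p j = v p j + h p *: phi j p + r j p.
  by rewrite /r [RHS]addrC -[v' p j - _ - _]addrA -opprD subrK.
rewrite /q v'j [dot (w i p) (_ + r j p)]dotDr dotDr dotZr.
rewrite {2 3}/w [dot _ (v p j)]dotDl [dot _ (phi j p)]dotDl !dotZl.
rewrite dot_v0 // dot_phi // [dot (A p *m v p i) (v p j)]dotC -/(m j i p).
ring.
Qed.

Let increment_small i : isO D h 2 (r i) -> isO D h 1 (fun p => v' p i - v p i).
Proof.
move=> ri; apply: (@isO_eq _ _ _ _ _ _ _ (fun p => h p *: phi i p + r i p)).
  by move=> p _; rewrite /r [RHS]addrC subrK.
apply: isOD; first exact: (isOZ (isO_step h01) (phi_bounded i)).
exact: (isO_weaken h01 _ ri).
Qed.

Let rho i p : 'cV[R]_d := y i p - v p i - h p *: psi i p.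

Let rho_small (i : 'I_k) : (forall j : 'I_k, (j < i)%N -> isO D h 2 (r j)) ->
  isO D h 2 (rho i).
Proof.
move=> r_small; pose c j p := 2 * (h p * (gamma * m j i p)).
apply: (@isO_eq _ _ _ _ _ _ _ (fun p => - \sum_(j < k | (j < i)%N)
    (q i j p *: v' p j + c j p *: (v' p j - v p j)))) => [p Dp|]; last first.
  apply: isON; apply: isO_sum => j ji; apply: isOD.
    exact: (isOZ (q_small ji (r_small j ji)) (v'_bounded j)).
  apply: (isOZ (m := 1) _ (increment_small (r_small j ji))).
  apply: (isOM (isO_cst D h (2 : R))); apply: (isOM (isO_step h01)).
  exact: (isOM gamma_bounded (m_bounded j i)).
under eq_bigr => j _.
  have -> : q i j p *: v' p j + c j p *: (v' p j - v p j)
    = dot (w i p) (v' p j) *: v' p j - c j p *: v p j.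
    by apply/matrixP => a b; rewrite !mxE /q /c; ring.
  over.
rewrite big_split /= sumrN.
have -> : \sum_(j < k | (j < i)%N) c j p *: v p j
    = (2 * (h p * gamma)) *: \sum_(j < k | (j < i)%N) m j i p *: v p j.
  by rewrite scaler_sumr; apply: eq_bigr => j _; rewrite scalerA /c !mulrA.
rewrite /rho /y /gram_schmidt_residual /psi /w.
set S := \sum_(j < k | _) dot _ _ *: _; set S' := \sum_(j < k | _) _.
by apply/matrixP => a b; rewrite !mxE; ring.
Qed.

Let u i p := dot (y i p) (y i p) - 1.

Section Normalization.
Variable i : 'I_k.
Hypothesis rho_i : isO D h 2 (rho i).

Let y_incr : isO D h 1 (fun p => y i p - v p i).
Proof.
apply: (@isO_eq _ _ _ _ _ _ _ (fun p => h p *: psi i p + rho i p)).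
  by move=> p _; rewrite /rho [RHS]addrC subrK.
apply: isOD; first exact: (isOZ (isO_step h01) (psi_bounded i)).
exact: (isO_weaken h01 _ rho_i).
Qed.

Let y_bounded : isO D h 0 (y i).
Proof.
apply: (@isO_eq _ _ _ _ _ _ _ (fun p => (y i p - v p i) + v p i)).
  by move=> p _; rewrite subrK.
by apply: isOD => //; exact: (isO_weaken h01 _ y_incr).
Qed.

Let u_expansion : isO D h 2 (fun p => u i p - 2 * (h p * (gamma * m i i p))).
Proof.
apply: (@isO_eq _ _ _ _ _ _ _ (fun p => 2 * dot (v p i) (rho i p)
   + dot (y i p - v p i) (y i p - v p i))) => [p Dp|]; last first.
  apply: isOD; last exact: (isO_dot y_incr y_incr).
  exact: (isOM (isO_cst D h (2 : R)) (isO_dot (v_bounded i) rho_i)).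
have yv : y i p - v p i = h p *: psi i p + rho i p.
  by rewrite /rho [RHS]addrC subrK.
have vy : dot (v p i) (y i p - v p i) = h p * (gamma * m i i p) + dot (v p i) (rho i p).
  by rewrite yv dotDr [dot _ (h p *: _)]dotZr dot_psi.
have vv : dot (v p i) (v p i) = 1 by rewrite v_orth // eqxx.
rewrite /u (dot_sqr_increment (y i p) (v p i)) vy vv.
ring.
Qed.

Let u_small : isO D h 1 (u i).
Proof.
apply: (@isO_eq _ _ _ _ _ _ _ (fun p => 2 * (h p * (gamma * m i i p))
   + (u i p - 2 * (h p * (gamma * m i i p))))) => [p Dp|]; first by ring.
apply: isOD; last exact: (isO_weaken h01 _ u_expansion).
apply: (isOM (isO_cst D h (2 : R))); apply: (isOM (isO_step h01)).
exact: (isOM gamma_bounded (m_bounded i i)).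
Qed.

Let large p := 1 / 2 <= enorm (y i p).

Lemma normalized_small : isO D h 2 (r i).
Proof.
apply: (@isO_case _ _ _ large) => [p /h01 /andP[] //||].
  pose D1 p := D p /\ large p.
  have sub n (V : normedModType R) (f : P -> V) : isO D h n f -> isO D1 h n f.
    by apply: isO_subdomain => p [].
  pose e p := (enorm (y i p))^-1 - 1 + u i p / 2.
  have e2 : isO D1 h 2 e.
    have [C uC] := sub _ _ _ (isOM (isO_cst D h (2 : R)) (isOM u_small u_small)).
    exists C => p D1p; apply: le_trans (uC p D1p).
    apply: le_trans (ler_norm _); rewrite -expr2.
    apply: inv_sqrt_taylor; first by case: D1p.
    by rewrite sqr_enorm /u subrKC.
  (* With rho = y - v - h psi and e = |y|^-1 - 1 + u / 2, expand
     |y|^-1 y = y - (u / 2) y + e y; the term (u / 2) y cancels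
     h gamma m v up to the products listed here. *)
  apply: (@isO_eq _ _ _ _ _ _ _ (fun p => rho i p + e p *: y i p
      - (2^-1 * u i p) *: (y i p - v p i)
      - (2^-1 * (u i p - 2 * (h p * (gamma * m i i p)))) *: v p i)).
    move=> p [Dp _]; rewrite /r v'E // /e /rho /phi.
    move: (enorm (y i p))^-1 => s; move: (u i p) => up.
    move: (y i p) (psi i p) (m i i p) => yp psip mp.
    by apply/matrixP => a b; rewrite !mxE; field.
  have half : isO D h 0 (fun=> 2^-1 : R) by exact: isO_cst.
  apply: isOB; first apply: isOB; first apply: isOD.
  - exact: sub.
  - exact: (isOZ e2 (sub _ _ _ y_bounded)).
  - exact/sub/(isOZ (isOM half u_small) y_incr).
  - exact/sub/(isOZ (isOM half u_expansion) (v_bounded i)).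
(* A residual shorter than 1 / 2 forces h to be bounded below, as u is of
   size h; then h^2 dominates any bounded quantity. *)
pose D2 p := D p /\ ~ large p.
have one_small : isO D2 h 1 (fun=> 1 : R).
  have [C uC] := isOM (isO_cst D h (2 : R)) u_small.
  exists C => p [Dp] /negP; rewrite -ltNge => sy.
  apply: le_trans (uC p Dp).
  have : dot (y i p) (y i p) < 1 / 4.
    rewrite -sqr_enorm; have := enorm_ge0 (y i p); nra.
  rewrite normr1 normrM ger0_norm // -normrN /u opprB => yy.
  by rewrite ger0_norm; lra.
apply: (@isO_eq _ _ _ _ _ _ _ (fun p => (1 * 1 : R) *: r i p)).
  by move=> p _; rewrite mulr1 scale1r.
apply: (isOZ (isOM one_small one_small)).
apply: (@isO_subdomain _ _ D) => [p []//|].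
apply: isOB; first by apply: isOB.
by apply: (isOZ (m := 0) _ (phi_bounded i)); apply: (isO_weaken h01 _ (isO_step h01)).
Qed.

End Normalization.

(** Strong induction on i: the expansion of the residual for index i uses the
    expansions of the new vectors with smaller index. *)
Lemma gram_schmidt_expansion i : isO D h 2 (r i).
Proof.
have [n] := ubnP (i : nat); elim: n i => // n IH i i_n.
apply: normalized_small; apply: rho_small => j ji; apply: IH.
exact: leq_trans ji i_n.
Qed.

End GramSchmidtStep.

(** * Symmetry of the Hessian *)

Section SymmetricHessian.
Context {R : realType} (d : nat).
Implicit Types (x u v : 'cV[R]_d).

Lemma directional_MVT (G : 'cV[R]_d -> R) x u (h : R) :
  0 < h -> (forall y, derivable G y u) ->
  exists2 c, 0 <= c <= h & G (x + h *: u) - G x = h * 'D_u G (x + c *: u).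
Proof.
move=> h0 dG; pose g (s : R) := G (x + s *: u).
have dg s : is_derive s (1 : R) g ('D_u G (x + s *: u)).
  have E : (fun r : R => r^-1 *: ((g \o shift s) (r *: (1 : R)) - g s))
    = (fun r => r^-1 *: ((G \o shift (x + s *: u)) (r *: u) - G (x + s *: u))).
    apply/funext => r /=; rewrite /g /shift /= [_ *: 1]mulr1 scalerDl.
    by rewrite addrCA [x + s *: u]addrC addrA [_ + x]addrC addrA.
  by split; rewrite /derivable /derive E //; exact: dG.
have cg : {within `[0, h], continuous g}.
  by apply: derivable_within_continuous => s _; case: (dg s).
have [c] := MVT_segment (ltW h0) (fun s _ => dg s) cg.
rewrite in_itv /= /g scale0r addr0 subr0 => hc ->.
by exists c => //; rewrite mulrC.
Qed.

(** The mean value theorem in direction u is applied to the difference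
    y |-> E (y + h v) - E y, then in direction v to its derivative. *)
Lemma second_difference_MVT (E : 'cV[R]_d -> R) x u v (h : R) :
  0 < h -> (forall y, derivable E y u) ->
  (forall y, derivable ('D_u E) y v) ->
  exists c c' : R, [/\ 0 <= c <= h, 0 <= c' <= h &
    E (x + h *: u + h *: v) - E (x + h *: u) - (E (x + h *: v) - E x)
    = h * (h * 'D_v ('D_u E) (x + c *: u + c' *: v))].
Proof.
move=> h0 dE ddE.
have quot_shift y :
    (fun r : R => r^-1 *: (((fun y => E (y + h *: v)) \o shift y) (r *: u)
       - E (y + h *: v)))
    = (fun r => r^-1 *: ((E \o shift (y + h *: v)) (r *: u) - E (y + h *: v))).
  by apply/funext => r /=; rewrite /shift /= addrA.
have dshift y : derivable (fun y => E (y + h *: v)) y u.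
  by rewrite /derivable quot_shift; exact: dE.
have [c hc] := @directional_MVT (fun y => E (y + h *: v) - E y) x u h h0
  (fun y => derivableB (dshift y) (dE y)).
rewrite deriveB //.
have -> : 'D_u (fun y => E (y + h *: v)) (x + c *: u)
        = 'D_u E (x + c *: u + h *: v).
  by rewrite /derive quot_shift.
have [c' hc' ->] := @directional_MVT ('D_u E) (x + c *: u) v h h0 ddE.
by move=> e; exists c, c'; split.
Qed.

Lemma not_both_close (p q s : R) :
  `|p - s| < `|p - q| / 2 -> `|q - s| < `|p - q| / 2 -> False.
Proof.
by move=> ps qs; have := ler_distD s p q; rewrite [`|s - q|]distrC; lra.
Qed.

(** Schwarz's theorem.  The second difference of E over a small square is
    symmetric in the two directions, so the two mixed derivatives, taken at
    suitable points of the square, coincide; both are close to their values at x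
    by continuity of the Hessian. *)
Lemma hessian_sym (E : 'cV[R]_d -> R) x :
  twice_continuously_differentiable E -> (hessian E x)^T = hessian E x.
Proof.
move=> [dE dgE cH].
pose e (i : 'I_d) : 'cV[R]_d := delta_mx i 0.
have dEi i y : derivable E y (e i) by exact: diff_derivable.
have gradE i : (fun y => grad E y i 0) = 'D_(e i) E.
  by apply/funext => y; rewrite mxE.
have dEij i j y : derivable ('D_(e i) E) y (e j).
  rewrite -gradE.
  by have /derivable_mxP := diff_derivable (v := e j) (dgE y); apply.
have HE i j y : hessian E y i j = 'D_(e j) ('D_(e i) E) y.
  by rewrite mxE gradE.
apply/matrixP => i j; rewrite mxE.
apply/eqP/negP => /negP neq.
pose eps := `|hessian E x j i - hessian E x i j| / 2.
have eps0 : 0 < eps by rewrite divr_gt0 // normr_gt0 subr_eq0.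
have := cH x; move/cvgrPdist_lt/(_ eps eps0)/nbhs_ballP => [r /= r0 near_r].
have near_x p q y : ball x r y ->
    `|hessian E x p q - 'D_(e q) ('D_(e p) E) y| < eps.
  rewrite -(HE p q y) => /near_r.
  exact: le_lt_trans (entry_dist_le _ _ p q).
(* The points involved are at distance at most 2 h < r from x. *)
pose h := r / 3.
have h0 : 0 < h by rewrite divr_gt0.
have in_r a b c c' : 0 <= c <= h -> 0 <= c' <= h ->
    ball x r (x + c *: e a + c' *: e b).
  move=> /andP[c0 ch] /andP[c'0 c'h].
  rewrite -ball_normE /= opprD opprD addrA addrA subrr add0r.
  have ne (q : 'I_d) : `|e q| <= 1.
    by apply: norm_le_entries => // p l; rewrite mxE; case: (_ && _); rewrite ?normr1 ?normr0.
  rewrite -opprD normrN (le_lt_trans (ler_normD _ _)) // !normrZ !ger0_norm //.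
  apply: (@le_lt_trans _ _ (h + h)).
    by apply: lerD; rewrite (le_trans (ler_wpM2l _ (ne _))) // mulr1.
  by rewrite /h; lra.
have [c [c' [hc hc' e1]]] := second_difference_MVT x h0 (dEi i) (dEij i j).
have [b [b' [hb hb' e2]]] := second_difference_MVT x h0 (dEi j) (dEij j i).
have e3 : 'D_(e j) ('D_(e i) E) (x + c *: e i + c' *: e j)
        = 'D_(e i) ('D_(e j) E) (x + b *: e j + b' *: e i).
  apply: (mulfI (lt0r_neq0 h0)); apply: (mulfI (lt0r_neq0 h0)).
  have swap (p q s t : R) : p - q - (s - t) = p - s - (q - t) by ring.
  apply: etrans (etrans (esym e1) _) e2.
  by rewrite swap (addrAC x (h *: e i) (h *: e j)).
apply: (not_both_close (s := 'D_(e i) ('D_(e j) E) (x + b *: e j + b' *: e i))).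
  exact/near_x/in_r.
by rewrite -e3; exact/near_x/in_r.
Qed.

End SymmetricHessian.

(** * Functions with one-sided derivatives on a segment *)

Section OneSidedDerivatives.
Context {R : realType}.

Lemma within_derivative_ball (V : normedModType R) (A : set R) (f : R -> V)
    (t : R) (l : V) (e : R) :
  (s - t)^-1 *: (f s - f t) @[s --> within A t^'] --> l -> 0 < e ->
  exists2 r : R, 0 < r & forall s, `|s - t| < r -> s != t -> A s ->
    `|l - (s - t)^-1 *: (f s - f t)| <= e.
Proof.
move=> /cvgrPdist_le/[apply]/nbhs_ballP[r /= r0 fr]; exists r => // s sr st As.
by apply: fr => //; rewrite -ball_normE /= distrC.
Qed.

(** Near t the difference quotient is bounded by |l| + 1, so f is locally
    Lipschitz at t along A; at the endpoints of a segment this gives the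
    one-sided continuity that the mean value theorem asks for. *)
Lemma within_derivative_continuous (V : normedModType R) (A : set R)
    (f : R -> V) (t : R) (l : V) :
  (s - t)^-1 *: (f s - f t) @[s --> within A t^'] --> l ->
  f s @[s --> within A (nbhs t)] --> f t.
Proof.
move=> df; have [r r0 fr] := within_derivative_ball df ltr01.
apply/cvgrPdist_le => e e0; apply/nbhs_ballP.
have l0 : 0 < `|l| + 1 by rewrite ltr_wpDl.
exists (Num.min r (e / (`|l| + 1))) => /= [|s].
  by rewrite lt_min r0 divr_gt0.
rewrite -ball_normE /= lt_min distrC => /andP[sr se] As.
have [->|st] := eqVneq s t; first by rewrite subrr normr0 ltW.
have ns : s - t != 0 by rewrite subr_eq0.
have -> : f t - f s = - ((s - t) *: ((s - t)^-1 *: (f s - f t))).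
  by rewrite scalerA divff // scale1r opprB.
rewrite normrN normrZ.
apply: (@le_trans _ _ (`|s - t| * (`|l| + 1))); last by rewrite -ler_pdivlMr // ltW.
rewrite ler_wpM2l // -[X in `|X|](subKr l) (le_trans (ler_normB _ _)) //.
by rewrite lerD2l fr.
Qed.

Variables (d : nat) (T : R).
Implicit Types f g : R -> 'cV[R]_d.

Lemma within_derivative_entry (A : set R) f t l i :
  has_derivative_within A f t l ->
  (s - t)^-1 *: (f s i 0 - f t i 0) @[s --> within A t^'] --> l i 0.
Proof.
move=> /cvgrPdist_le df; apply/cvgrPdist_le => e /df; apply: filterS => s.
apply: le_trans; have := entry_dist_le l ((s - t)^-1 *: (f s - f t)) i 0.
by rewrite !mxE.
Qed.

Lemma is_derive_interior (g : R -> R) (t l : R) : 0 < t < T ->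
  (s - t)^-1 *: (g s - g t) @[s --> within `[0, T] t^'] --> l ->
  is_derive t (1 : R) g l.
Proof.
move=> /andP[t0 tT] dg.
suff q : (fun h : R => h^-1 *: ((g \o shift t) (h *: (1 : R)) - g t)) @ 0^' --> l.
  by split; [apply/cvg_ex; exists l | exact/cvg_lim].
apply/cvgrPdist_le => e e0; have [r r0 gr] := within_derivative_ball dg e0.
apply/nbhs_ballP; exists (Num.min r (Num.min t (T - t))) => /=.
  by rewrite !lt_min r0 t0 subr_gt0.
move=> h; rewrite -ball_normE /= sub0r normrN !lt_min => /and3P[hr ht hT] h0.
have := gr (h + t); rewrite addrK /shift /= [_ *: 1]mulr1; apply => //.
  by rewrite -subr_eq0 addrK.
by move: ht hT; rewrite !ltr_norml /= in_itv /=; lra.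
Qed.

Variables f f' : R -> 'cV[R]_d.
Hypothesis df : forall t, 0 <= t <= T -> has_derivative_within `[0, T] f t (f' t).

Lemma bounded_on_segment : exists M, forall t, 0 <= t <= T -> `|f t| <= M.
Proof.
have cf : {within `[0, T], continuous f}.
  apply/subspace_continuousP => t /= tT.
  apply: (@within_derivative_continuous _ _ f t (f' t)); apply: df.
  by move: tT; rewrite in_itv.
have [M [_ HM]] := compact_bounded (continuous_compact cf (@segment_compact R 0 T)).
exists (M + 1) => t tT; apply: (HM (M + 1)); first by rewrite ltrDl.
by exists t => //=; rewrite in_itv.
Qed.

(** The intermediate point depends on the entry, which is why the bounds below
    are first proved entry by entry. *)
Lemma entry_MVT s t i : 0 <= s -> s <= t -> t <= T ->
  exists2 c, s <= c <= t & f t i 0 - f s i 0 = f' c i 0 * (t - s).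
Proof.
move=> s0 st tT.
have dfi c : c \in `]s, t[%R -> is_derive c 1 (fun r => f r i 0) (f' c i 0).
  rewrite in_itv /= => /andP[sc ct].
  apply: is_derive_interior.
    by rewrite (le_lt_trans s0 sc) (lt_le_trans ct tT).
  apply: within_derivative_entry; apply: df.
  by rewrite (le_trans s0 (ltW sc)) (le_trans (ltW ct) tT).
have cf : {within `[s, t], continuous (fun r => f r i 0)}.
  apply: (@continuous_subspaceW _ _ _ `[0, T]%classic).
    move=> r /=; rewrite !in_itv /= => /andP[sr rt].
    by rewrite (le_trans s0 sr) (le_trans rt tT).
  apply/subspace_continuousP => r /= rT.
  apply: (@within_derivative_continuous _ _ (fun r => f r i 0) r (f' r i 0)).
  by apply: within_derivative_entry; apply: df; move: rT; rewrite in_itv.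
have [c] := MVT_segment st dfi cf.
by rewrite in_itv /=; exists c.
Qed.

Lemma increment_le B s t : (forall c, 0 <= c <= T -> `|f' c| <= B) ->
  0 <= s -> s <= t -> t <= T -> `|f t - f s| <= B * (t - s).
Proof.
move=> f'B s0 st tT.
have ts0 : 0 <= t - s by rewrite subr_ge0.
have B0 : 0 <= B by rewrite (le_trans _ (f'B s _)) // s0 (le_trans st tT).
apply: norm_le_entries => [|i j]; first by rewrite mulr_ge0.
have [c /andP[sc ct] e] := entry_MVT i s0 st tT.
rewrite ord1 !mxE e normrM (ger0_norm ts0) ler_wpM2r //.
rewrite (le_trans (entry_le_norm _ _ _)) // f'B //.
by rewrite (le_trans s0 sc) (le_trans ct tT).
Qed.

Lemma linearization_le B s t : 0 <= B ->
  (forall a b, 0 <= a <= T -> 0 <= b <= T -> `|f' a - f' b| <= B * `|a - b|) ->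
  0 <= s -> s <= t -> t <= T ->
  `|f t - f s - (t - s) *: f' s| <= B * (t - s) ^+ 2.
Proof.
move=> B0 f'B s0 st tT.
have ts0 : 0 <= t - s by rewrite subr_ge0.
apply: norm_le_entries => [|i j]; first by rewrite mulr_ge0 // sqr_ge0.
have [c /andP[sc ct] e] := entry_MVT i s0 st tT.
rewrite ord1 !mxE e mulrC -mulrBr normrM (ger0_norm ts0) expr2 mulrCA ler_wpM2l //.
rewrite (le_trans (entry_dist_le _ _ _ _)) // (le_trans (f'B _ _ _ _)) //.
- by rewrite (le_trans s0 sc) (le_trans ct tT).
- by rewrite s0 (le_trans st tT).
- by rewrite ler_wpM2l // ger0_norm ?subr_ge0 // lerD2r.
Qed.

End OneSidedDerivatives.

(** * One step of the scheme *)

Section GramSchmidtOrthonormal.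
Context {R : realType} (d k : nat).

(** If the j-th vector is a unit vector orthogonal to the previous ones, the
    component along it of a later residual cancels exactly. *)
Lemma gram_schmidt_orthonormal (v w : 'I_k -> 'cV[R]_d) :
  (forall i, v i = (enorm (gram_schmidt_residual v i (w i)))^-1
                     *: gram_schmidt_residual v i (w i)) ->
  (forall i, v i != 0) -> orthonormal_family v.
Proof.
move=> vE v0; pose y i := gram_schmidt_residual v i (w i).
have vv i : dot (v i) (v i) = 1.
  have yi0 : enorm (y i) != 0.
    apply: contra_neq (v0 i) => /enorm_eq0 yi; rewrite vE -/(y i) yi scaler0.
    exact: erefl.
  by rewrite vE -/(y i) dotZl dotZr -sqr_enorm expr2 mulKf // mulVf.
have vlt (i j : 'I_k) : (j < i)%N -> dot (v i) (v j) = 0.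
  have [n] := ubnP (i : nat); elim: n i j => // n IH i j i_n ji.
  rewrite (vE i) dotZl; apply/eqP; rewrite mulf_eq0; apply/orP; right; apply/eqP.
  rewrite /gram_schmidt_residual dotBl.
  rewrite [dot (\sum_(_ < _ | _) _) _]dotC dot_sumr (bigD1 j) //= big1 => [|l /andP[li lj]].
    by rewrite dotZr vv mulr1 addr0 subrr.
  rewrite dotZr; have [lt_lj|lt_jl|/val_inj e] := ltngtP l j.
  - by rewrite (IH j l) ?mulr0 // (leq_trans ji).
  - by rewrite [dot (v j) _]dotC (IH l j) ?mulr0 // (leq_trans li).
  - by rewrite e eqxx in lj.
move=> i j; have [lt_ij|lt_ji|/val_inj ->] := ltngtP i j.
- by rewrite dotC vlt // -val_eqE /= ltn_eqF.
- by rewrite vlt // -val_eqE /= gtn_eqF.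
- by rewrite vv eqxx.
Qed.

Lemma unit_norm_ge (u : 'cV[R]_d) : dot u u = 1 -> 1 <= d%:R * `|u|.
Proof. by move=> u1; have := enorm_le_norm u; rewrite /enorm u1 sqrtr1. Qed.

End GramSchmidtOrthonormal.

Section Fields.
Context {R : realType} (d k : nat).
Variables (F : 'cV[R]_d -> 'cV[R]_d) (J : 'cV[R]_d -> 'M[R]_d).
Variables (beta gamma LF LJ : R).
Hypothesis lipF : forall x y, `|F x - F y| <= LF * `|x - y|.
Hypothesis lipJ : forall x y, `|J x - J y| <= LJ * `|x - y|.
Hypothesis J_sym : forall x, (J x)^T = J x.

Local Notation state := (state (R := R) d k).
Implicit Types z w : state.

(** The form in which the first-order terms of a Gram-Schmidt step appear. *)
Lemma direction_fieldE i z : direction_field J gamma i z =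
  gamma *: (J z.1 *m z.2 i
    - 2 *: \sum_(j < k | (j < i)%N) dot (z.2 j) (J z.1 *m z.2 i) *: z.2 j)
  - (gamma * dot (z.2 i) (J z.1 *m z.2 i)) *: z.2 i.
Proof.
rewrite /direction_field -mulmxA !mulmxBl mul1mx outer_mulmx -scalemxAl mulmx_suml.
under eq_bigr do rewrite outer_mulmx.
by rewrite addrAC scalerBr scalerA.
Qed.

Lemma direction_fields_bounded_lipschitz M : exists2 C, 0 <= C &
  forall z w i, in_ball M z -> in_ball M w ->
    `|direction_field J gamma i z| <= C /\
    `|direction_field J gamma i z - direction_field J gamma i w|
      <= C * state_dist z w.
Proof.
have [B vB] := choice (fun i => direction_field_bounded_lipschitz (k := k) gamma lipJ M i).
have BS i : B i <= \sum_j `|B j|.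
  by rewrite (bigD1 i) //= (le_trans (ler_norm _)) // lerDl sumr_ge0.
exists (\sum_j `|B j|) => [|z w i zM wM]; first by rewrite sumr_ge0.
have [vb vl] := vB i z w zM wM; split; first exact: le_trans (BS i).
by rewrite (le_trans vl) // ler_wpM2r // state_dist_ge0.
Qed.

Lemma fields_bounded_lipschitz M : exists2 C, 0 <= C &
  forall z w, in_ball M z -> in_ball M w ->
  [/\ `|position_field F beta z| <= C,
      `|position_field F beta z - position_field F beta w| <= C * state_dist z w,
      forall i, `|direction_field J gamma i z| <= C &
      forall i, `|direction_field J gamma i z - direction_field J gamma i w|
                  <= C * state_dist z w].
Proof.
have [A xA] := position_field_bounded_lipschitz k beta lipF M.
have [B B0 vB] := direction_fields_bounded_lipschitz M.
exists (`|A| + B) => [|z w zM wM]; first by rewrite addr_ge0.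
have lA : A <= `|A| + B by rewrite (le_trans (ler_norm A)) // lerDl.
have lB : B <= `|A| + B by rewrite lerDr.
have [xb xl] := xA z w zM wM; split=> [||i|i].
- exact: le_trans lA.
- by rewrite (le_trans xl) // ler_wpM2r // state_dist_ge0.
- by have [vb _] := vB z w i zM wM; rewrite (le_trans vb).
- have [_ vl] := vB z w i zM wM.
  by rewrite (le_trans vl) // ler_wpM2r // state_dist_ge0.
Qed.

Definition gram_schmidt_step (h : R) z (v' : 'I_k -> 'cV[R]_d) :=
  forall i, let y := gram_schmidt_residual v' i
                       (z.2 i + (h * gamma) *: (J z.1 *m z.2 i)) in
    v' i = (enorm y)^-1 *: y.

Lemma gram_schmidt_consistent M : exists2 C, 0 <= C &
  forall h z v', 0 <= h <= 1 -> in_ball M z -> orthonormal_family z.2 ->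
    gram_schmidt_step h z v' ->
  forall i, `|v' i - z.2 i - h *: direction_field J gamma i z| <= C * h ^+ 2.
Proof.
pose D (p : R * state * ('I_k -> 'cV[R]_d)) :=
  [/\ 0 <= p.1.1 <= 1, in_ball M p.1.2, orthonormal_family p.1.2.2
    & gram_schmidt_step p.1.1 p.1.2 p.2].
pose h (p : R * state * ('I_k -> 'cV[R]_d)) := p.1.1.
have h01 p : D p -> 0 <= h p <= 1 by case.
have Jb : isO D h 0 (fun p => J p.1.2.1).
  have [C JC] := position_map_bounded_lipschitz k M lipJ.
  by apply: (@isO_bounded _ _ _ _ _ C) => p [_ zM _ _]; case: (JC _ _ zM zM).
have [C hC] := choice (gram_schmidt_expansion (v := fun p => p.1.2.2)
  (v' := snd) (gamma := gamma) h01 (fun p '(And4 _ _ o _) => o)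
  (fun p _ => J_sym p.1.2.1) Jb (fun p i '(And4 _ _ _ s) => s i)).
exists (\sum_i `|C i|) => [|s z v' s01 zM zo st i]; first by rewrite sumr_ge0.
have := hC i (s, z, v') (And4 s01 zM zo st); rewrite -direction_fieldE => /le_trans.
apply; rewrite ler_wpM2r ?sqr_ge0 // (bigD1 i) //= (le_trans (ler_norm _)) //.
by rewrite lerDl sumr_ge0.
Qed.

(** By consistency v' i differs from the unit vector v i by O(h), so for small
    h it is nonzero, and hence no residual vanishes. *)
Lemma gram_schmidt_step_orthonormal M : exists2 h0, 0 < h0 &
  forall h z v', 0 <= h <= h0 -> in_ball M z -> orthonormal_family z.2 ->
    gram_schmidt_step h z v' -> orthonormal_family v'.
Proof.
have [C C0 hC] := gram_schmidt_consistent M.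
have [B B0 hB] := direction_fields_bounded_lipschitz M.
pose K := d%:R * (C + B) + 1.
have K0 : 0 < K by rewrite ltr_wpDl // mulr_ge0 // addr_ge0.
exists (2 * K)^-1 => [|h z v' /andP[h0 hK] zM zo st].
  by rewrite invr_gt0 mulr_gt0.
have hK2 : h * K <= 1 / 2.
  have := ler_wpM2r (ltW K0) hK; rewrite invfM mulfVK ?lt0r_neq0 // mul1r //.
have h1 : h <= 1.
  have : h * 1 <= h * K.
    by rewrite ler_wpM2l // /K lerDr mulr_ge0 // addr_ge0.
  lra.
apply: (gram_schmidt_orthonormal st) => i; apply/eqP => v'0.
have := hC h z v' _ zM zo st i; rewrite h0 h1 v'0 sub0r => /(_ isT) vi.
have [Bi _] := hB z z i zM zM.
have zi : `|z.2 i| <= (C + B) * h.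
  rewrite -normrN -[- z.2 i](subrK (h *: direction_field J gamma i z)).
  rewrite (le_trans (ler_normD _ _)) // mulrDl lerD //.
    by rewrite (le_trans vi) // ler_wpM2l // expr2 ler_piMl.
  by rewrite normrZ ger0_norm // mulrC ler_wpM2r.
have z1 : dot (z.2 i) (z.2 i) = 1 by rewrite zo eqxx.
have := unit_norm_ge z1; have := ler_wpM2l (ler0n R d) zi.
by move: hK2; rewrite /K; lra.
Qed.

End Fields.

(** * Stability and convergence *)

Section Gronwall.
Context {R : realType}.
Implicit Types a : nat -> R.

Lemma discrete_gronwall a (c b : R) N :
  0 <= a 0%N -> 0 <= c -> 0 <= b ->
  (forall n, (n < N)%N -> a n.+1 <= (1 + c) * a n + b) ->
  forall n, (n <= N)%N -> a n <= (1 + c) ^+ n * (a 0%N + n%:R * b).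
Proof.
move=> a0 c0 b0 aS; elim=> [|n IH] nN; first by rewrite expr0 mul1r mul0r addr0.
have c1 : 1 <= 1 + c by rewrite lerDl.
rewrite (le_trans (aS n nN)) //.
rewrite (@le_trans _ _ ((1 + c) ^+ n.+1 * (a 0%N + n%:R * b) + b)) //.
  by rewrite lerD2r exprS -mulrA ler_wpM2l ?IH ?(ltnW nN) // (le_trans ler01).
rewrite -natr1 mulrDl mul1r addrA [leRHS]mulrDr lerD2l.
by rewrite ler_peMl // exprn_ege1.
Qed.

(** (1 + C h)^n <= exp (C n h) <= exp (C T): the bound does not depend on the
    number of steps. *)
Lemma gronwall_exp a (C B h T : R) N :
  0 <= a 0%N -> 0 <= C -> 0 <= B -> 0 <= h -> N%:R * h <= T ->
  (forall n, (n < N)%N -> a n.+1 <= (1 + C * h) * a n + B * h) ->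
  forall n, (n <= N)%N -> a n <= expR (C * T) * (a 0%N + B * T).
Proof.
move=> a0 C0 B0 h0 NT aS n nN.
have nT : n%:R * h <= T by rewrite (le_trans _ NT) // ler_wpM2r // ler_nat.
have Ch0 : 0 <= C * h by rewrite mulr_ge0.
have Bh0 : 0 <= B * h by rewrite mulr_ge0.
rewrite (le_trans (discrete_gronwall a0 Ch0 Bh0 aS nN)) //.
rewrite ler_pM ?exprn_ge0 ?addr_ge0 ?mulr_ge0 //.
  rewrite (@le_trans _ _ (expR (C * h) ^+ n)) //.
    by rewrite lerXn2r ?nnegrE ?expR_ge0 ?addr_ge0 // expR_ge1Dx.
  by rewrite -expRM_natl ler_expR mulrCA ler_wpM2l.
by rewrite lerD2l mulrCA ler_wpM2l.
Qed.

End Gronwall.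

Section Convergence.
Context {R : realType} (d k : nat).
Variables (F : 'cV[R]_d -> 'cV[R]_d) (J : 'cV[R]_d -> 'M[R]_d).
Variables (beta gamma LF LJ T : R).
Hypothesis lipF : forall x y, `|F x - F y| <= LF * `|x - y|.
Hypothesis lipJ : forall x y, `|J x - J y| <= LJ * `|x - y|.
Hypothesis J_sym : forall x, (J x)^T = J x.
Hypotheses (beta_ge0 : 0 <= beta) (T_ge0 : 0 <= T).
Variables (x0 : 'cV[R]_d) (v0 : 'I_k -> 'cV[R]_d).
Hypothesis v0_orth : orthonormal_family v0.

Local Notation state := (state (R := R) d k).
Implicit Types z w : state.

Section ExactSolution.
Variables (x : R -> 'cV[R]_d) (v : 'I_k -> R -> 'cV[R]_d).
Hypothesis sol : HiSD_solution F J T beta gamma x0 v0 x v.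

Let z t : state := (x t, v^~ t).

Let dx t : 0 <= t <= T ->
  has_derivative_within `[0, T] x t (position_field F beta (z t)).
Proof. by case: sol => _ _ + _; apply. Qed.

Let dv i t : 0 <= t <= T ->
  has_derivative_within `[0, T] (v i) t (direction_field J gamma i (z t)).
Proof. by case: sol => _ _ _ + tT; apply. Qed.

Lemma solution_bounded : exists M, forall t, 0 <= t <= T -> in_ball M (z t).
Proof.
have [Mx xM] := bounded_on_segment dx.
have [Mv vM] := choice (fun i => bounded_on_segment (@dv i)).
exists (`|Mx| + \sum_i `|Mv i|) => t tT; split=> [|i] /=.
  by rewrite (le_trans (xM t tT)) // (le_trans (ler_norm _)) // lerDl sumr_ge0.
rewrite (le_trans (vM i t tT)) // (le_trans (ler_norm _)) // (bigD1 i) //=.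
by rewrite addrCA lerDl addr_ge0 // sumr_ge0.
Qed.

(** Bounded velocity makes the solution Lipschitz in time; as the fields are
    Lipschitz on the ball that contains it, its velocity is Lipschitz in time
    too, which is what a first-order expansion with quadratic error needs. *)
Lemma solution_consistent : exists2 C, 0 <= C &
  forall s t, 0 <= s -> s <= t -> t <= T ->
  `|x t - x s - (t - s) *: position_field F beta (z s)| <= C * (t - s) ^+ 2 /\
  forall i, `|v i t - v i s - (t - s) *: direction_field J gamma i (z s)|
              <= C * (t - s) ^+ 2.
Proof.
have [M zM] := solution_bounded.
have [B B0 hB] := fields_bounded_lipschitz k beta gamma lipF lipJ M.
have xB c : 0 <= c <= T -> `|position_field F beta (z c)| <= B.
  by move=> cT; have [] := hB _ _ (zM c cT) (zM c cT).
have vB i c : 0 <= c <= T -> `|direction_field J gamma i (z c)| <= B.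
  by move=> cT; have [_ _ + _] := hB _ _ (zM c cT) (zM c cT).
pose K := B + \sum_(i < k) B.
have K0 : 0 <= K by rewrite addr_ge0 // sumr_ge0.
have zlip a b : 0 <= a <= T -> 0 <= b <= T ->
    state_dist (z a) (z b) <= K * `|a - b|.
  wlog ba : a b / b <= a => [th aT bT|/andP[a0 aT] /andP[b0 bT]].
    have [ba|/ltW ab] := leP b a; first exact: th.
    by rewrite state_distC [`|a - b|]distrC; exact: th.
  rewrite ger0_norm ?subr_ge0 // mulrDl mulr_suml lerD //.
    exact: (increment_le dx xB b0 ba aT).
  by rewrite ler_sum // => i _; exact: (increment_le (@dv i) (vB i) b0 ba aT).
exists (B * K) => [|s t s0 st tT]; first by rewrite mulr_ge0.
split=> [|i].
  apply: (linearization_le dx) => //; first by rewrite mulr_ge0.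
  move=> a b aT bT; have [_ + _ _] := hB _ _ (zM a aT) (zM b bT).
  by move=> /le_trans; apply; rewrite -mulrA ler_wpM2l // zlip.
apply: (linearization_le (@dv i)) => //; first by rewrite mulr_ge0.
move=> a b aT bT; have [_ _ _ /(_ i)] := hB _ _ (zM a aT) (zM b bT).
by move=> /le_trans; apply; rewrite -mulrA ler_wpM2l // zlip.
Qed.

End ExactSolution.

(** The reflection 1 - 2 sum v_j v_j^T is bounded for orthonormal v, so the field
    inherits linear growth from F, uniformly in the unbounded variable x. *)
Lemma position_field_growth : exists2 C, 0 <= C &
  forall z, orthonormal_family z.2 ->
    `|position_field F beta z| <= C * (1 + `|z.1|).
Proof.
pose K : R := d%:R * (1 + 2 * k%:R).
pose A := `|F 0| + `|LF|.
exists (beta * (K * A)) => [|z zo].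
  by rewrite !mulr_ge0 ?addr_ge0 ?mulr_ge0.
have reflection : `|1%:M - 2 *: \sum_(j < k) z.2 j *m (z.2 j)^T| <= 1 + 2 * k%:R.
  rewrite (le_trans (ler_normB _ _)) // lerD //.
    by apply: norm_le_entries => // i j; rewrite mxE; case: (_ == _); rewrite ?normr1 ?normr0.
  rewrite normrZ ger0_norm // ler_wpM2l // (le_trans (ler_norm_sum _ _ _)) //.
  rewrite -[X in _ <= X%:R]card_ord -sumr_const ler_sum // => j _.
  have z1 : `|z.2 j| <= 1 by rewrite norm_unit_le1 // zo eqxx.
  rewrite (le_trans (norm_mulmx _ _)) // mul1r mulr_ile1 //.
  by rewrite (le_trans (norm_trmx_le _)).
have FA : `|F z.1| <= A * (1 + `|z.1|).
  rewrite -[F z.1](subrK (F 0)) addrC (le_trans (ler_normD _ _)) //.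
  have Fz : `|F z.1 - F 0| <= `|LF| * `|z.1|.
    by rewrite (le_trans (lipF _ _)) // subr0 ler_wpM2r // ler_norm.
  rewrite mulrDr mulr1 -addrA lerD2l (le_trans Fz) //.
  by rewrite /A mulrDl addrA lerDr addr_ge0 // mulr_ge0.
rewrite normrZ ger0_norm // -!mulrA ler_wpM2l // (le_trans (norm_mulmx _ _)) //.
by rewrite mulrA ler_pM ?mulr_ge0 // ler_wpM2l.
Qed.

(** The position bound needs orthonormality at all earlier steps, and
    orthonormality at the next step needs the position bound, so the two are
    proved together.  The radius M is fixed beforehand by Gronwall, the step
    bound h0 afterwards. *)
Lemma scheme_invariant : exists2 h0, 0 < h0 & exists M : R,
  forall (N : nat) (h : R), 0 <= h <= h0 -> N%:R * h <= T ->
  forall xd vd, HiSD_scheme F J h beta gamma N x0 v0 xd vd ->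
  forall n, (n <= N)%N -> orthonormal_family (vd n) /\ in_ball M (xd n, vd n).
Proof.
have [C C0 hC] := position_field_growth.
pose M := expR (C * T) * (`|x0| + C * T) + 1.
have [h0 h0_gt0 hS] := gram_schmidt_step_orthonormal k gamma lipJ J_sym M.
exists h0 => //; exists M => N h hh0 NT xd vd [xd0 vd0 xS vS].
have M1 : 1 <= M.
  by rewrite lerDr mulr_ge0 ?expR_ge0 // addr_ge0 // mulr_ge0.
have ball n : orthonormal_family (vd n) -> `|xd n| <= M -> in_ball M (xd n, vd n).
  by move=> vo xM; split=> // i /=; rewrite (le_trans _ M1) // norm_unit_le1 // vo eqxx.
suff inv n : (n <= N)%N ->
    forall m, (m <= n)%N -> orthonormal_family (vd m) /\ `|xd m| <= M.
  by move=> n nN; have [vo xM] := inv n nN n (leqnn n); split=> //; exact: ball.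
have /andP[h_ge0 _] := hh0.
elim: n => [_|n IH nN] m.
  rewrite leqn0 => /eqP ->; split; first by move=> i j; rewrite !vd0 v0_orth.
  rewrite xd0 (le_trans _ (_ : expR (C * T) * (`|x0| + C * T) <= M)) ?lerDl //.
  rewrite -[leLHS]mul1r ler_pM //.
    by rewrite (le_trans _ (expR_ge1Dx _)) // lerDl mulr_ge0.
  by rewrite lerDl mulr_ge0.
rewrite leq_eqVlt => /predU1P[->|]; last by rewrite ltnS => /(IH (ltnW nN)).
split.
  have [vo xM] := IH (ltnW nN) n (leqnn n).
  apply: (hS h (xd n, vd n)) => //; first exact: ball.
  by move=> i; exact: vS.
apply: (@le_trans _ _ (expR (C * T) * (`|x0| + C * T))); last by rewrite lerDl.
rewrite -xd0; apply: (gronwall_exp (a := fun n => `|xd n|) (h := h) (N := n.+1)) (leqnn _) => //.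
  by rewrite (le_trans _ NT) // ler_wpM2r // ler_nat.
move=> l ln; have [vo _] := IH (ltnW nN) l ln.
have := hC (xd l, vd l) vo; rewrite xS ?(leq_trans ln nN) //.
rewrite -scalerA -/(position_field F beta (xd l, vd l)) /= => pC.
rewrite (le_trans (ler_normD _ _)) // normrZ (ger0_norm h_ge0).
have := ler_wpM2l h_ge0 pC; nra.
Qed.

(** One step of two approximate Euler orbits, a with slope p and b with slope q:
    the last two terms are the local errors. *)
Lemma error_propagation (V : normedModType R) (h : R) (a a' b b' p q : V) :
  0 <= h ->
  `|a' - b'| <= `|a - b| + h * `|p - q|
                + (`|a' - a - h *: p| + `|b' - b - h *: q|).
Proof.
move=> h0; rewrite -[h in h * _](ger0_norm h0) -normrZ scalerBr.
have split3 (c c' w : V) : c' = c + w + (c' - c - w).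
  by rewrite [RHS]addrC -[c' - c - w]addrA -opprD subrK.
have -> : a' - b' = (a - b) + (h *: p - h *: q)
    + ((a' - a - h *: p) - (b' - b - h *: q)).
  rewrite {1}(split3 a a' (h *: p)) {1}(split3 b b' (h *: q)).
  by rewrite opprD addrACA opprD [a + _ + _]addrACA.
by rewrite (le_trans (ler_normD _ _)) // lerD ?ler_normB ?ler_normD.
Qed.

(** The Lipschitz constant is taken on a ball that contains both the exact
    solution and all iterates.  The local error is K' h^2 = (K' h) h, and
    Gronwall is applied with the source K' h. *)
Lemma euler_convergence (x : R -> 'cV[R]_d) (v : 'I_k -> R -> 'cV[R]_d) :
  HiSD_solution F J T beta gamma x0 v0 x v ->
  exists h0 Q : R, [/\ 0 < h0, 0 <= Q &
    forall (N : nat) (h : R), 0 <= h <= h0 -> N%:R * h <= T ->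
    forall xd vd, HiSD_scheme F J h beta gamma N x0 v0 xd vd ->
    forall n, (n <= N)%N ->
      state_dist (x (n%:R * h), fun i => v i (n%:R * h)) (xd n, vd n) <= Q * h].
Proof.
move=> sol.
have [M1 zM1] := solution_bounded sol.
have [C1 C10 zC] := solution_consistent sol.
have [h1 h1_gt0 [M2 inv]] := scheme_invariant.
have [C2 C20 gsC] := gram_schmidt_consistent k gamma lipJ J_sym M2.
pose M := Num.max M1 M2.
have [B B0 lip] := fields_bounded_lipschitz k beta gamma lipF lipJ M.
pose K : R := B + \sum_(i < k) B.
pose K' : R := C1 + \sum_(i < k) (C1 + C2).
have K0 : 0 <= K by rewrite addr_ge0 // sumr_ge0.
have K'0 : 0 <= K' by rewrite addr_ge0 // sumr_ge0 // => i _; rewrite addr_ge0.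
exists (Num.min h1 1), (expR (K * T) * (K' * T)); split.
- by rewrite lt_min h1_gt0 ltr01.
- by rewrite mulr_ge0 ?expR_ge0 // mulr_ge0.
move=> N h /andP[h0]; rewrite le_min => /andP[hh1 hle1] NT xd vd sch n nN.
pose z l : state := (x (l%:R * h), fun i => v i (l%:R * h)).
pose zd l : state := (xd l, vd l).
have [xd0 vd0 xS vS] := sch; have [x00 v00 _ _] := sol.
have d0 : state_dist (z 0%N) (zd 0%N) = 0.
  rewrite /state_dist /= mul0r x00 xd0 subrr normr0 add0r big1 // => i _.
  by rewrite v00 vd0 subrr normr0.
have := @gronwall_exp _ (fun l => state_dist (z l) (zd l)) K (K' * h) h T N.
rewrite d0 add0r => /(_ _ _ _ _ _ _ n nN) H.
rewrite (_ : _ * _ * h = expR (K * T) * (K' * h * T)); last by ring.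
apply: H => //; first by rewrite mulr_ge0.
move=> l lN; set e := state_dist (z l) (zd l).
have tT m : (m <= N)%N -> 0 <= m%:R * h <= T.
  by move=> mN; rewrite mulr_ge0 //= (le_trans _ NT) // ler_wpM2r // ler_nat.
have /andP[s0 _] := tT l (ltnW lN); have /andP[_ lT] := tT l.+1 lN.
have stepE : l.+1%:R * h - l%:R * h = h by rewrite -natr1 mulrDl mul1r addrC addKr.
have st : l%:R * h <= l.+1%:R * h by rewrite -subr_ge0 stepE.
have [xC vC] := zC _ _ s0 st lT; rewrite stepE in xC vC.
have [vo zdM2] := inv N h (introT andP (conj h0 hh1)) NT xd vd sch l (ltnW lN).
have wider M' w : M' <= M -> in_ball M' w -> in_ball M w.
  by move=> MM [w1 w2]; split=> [|i]; rewrite (le_trans _ MM).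
have zM : in_ball M (z l).
  by apply: wider (zM1 _ (tT l (ltnW lN))); rewrite /M le_max lexx.
have zdM : in_ball M (zd l) by apply: wider zdM2; rewrite /M le_max lexx orbT.
have [_ xl _ vl] := lip _ _ zM zdM.
have gs i : `|vd l.+1 i - vd l i - h *: direction_field J gamma i (zd l)| <= C2 * h ^+ 2.
  apply: (gsC h (zd l) (vd l.+1)) => //; first by rewrite h0.
  by move=> j; exact: vS.
have xd_exact : xd l.+1 - xd l - h *: position_field F beta (zd l) = 0.
  rewrite xS // -scalerA -/(position_field F beta (zd l)).
  by rewrite [xd l + _]addrC addrK subrr.
have -> : (1 + K * h) * e + K' * h * h
  = (`|x (l%:R * h) - xd l| + h * (B * e) + C1 * h ^+ 2)
    + \sum_(i < k) (`|v i (l%:R * h) - vd l i| + h * (B * e) + (C1 + C2) * h ^+ 2).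
  rewrite !big_split /=.
  have -> : \sum_(i < k) (C1 + C2) * h ^+ 2 = (\sum_(i < k) (C1 + C2)) * h ^+ 2.
    by rewrite mulr_suml.
  have -> : \sum_(i < k) h * (B * e) = (\sum_(i < k) B) * (h * e).
    by rewrite mulr_suml; apply: eq_bigr => i _; ring.
  have eE : e = `|x (l%:R * h) - xd l| + \sum_(i < k) `|v i (l%:R * h) - vd l i|.
    by [].
  by rewrite mulrDl mul1r {1}eE /K /K'; ring.
apply: lerD => /=.
  rewrite (le_trans (error_propagation (x (l%:R * h)) _ (xd l) _
    (position_field F beta (z l)) (position_field F beta (zd l)) h0)) //.
  by rewrite xd_exact normr0 addr0 lerD // lerD2l ler_wpM2l.
apply: ler_sum => i _.
rewrite (le_trans (error_propagation (v i (l%:R * h)) _ (vd l i) _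
    (direction_field J gamma i (z l)) (direction_field J gamma i (zd l)) h0)) //.
rewrite lerD //; first by rewrite lerD2l ler_wpM2l.
by rewrite mulrDl lerD // vC.
Qed.

End Convergence.

Lemma lipschitz_max_norm (R : realType) (d : nat) (L : R)
    (F : 'cV[R]_d -> 'cV[R]_d) (J : 'cV[R]_d -> 'M[R]_d) :
  0 <= L -> lipschitz_linear_growth L F J ->
  (forall x y, `|F x - F y| <= L * d%:R * `|x - y|) /\
  (forall x y, `|J x - J y| <= L * d%:R * `|x - y|).
Proof.
move=> L0 [lip _]; split=> x y; rewrite -mulrA;
  apply: le_trans (ler_wpM2l L0 (enorm_le_norm (x - y))); apply: le_trans (lip y x).
  rewrite (le_trans (norm_le_enorm _)) // lerDr.
  exact: le_trans (normr_ge0 _) (norm_le_opnorm _).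
by rewrite (le_trans (norm_le_opnorm _)) // lerDl enorm_ge0.
Qed.

Theorem theorem3p1 (R : realType) (d k : nat) (hk : (1 <= k <= d)%N)
    (E : 'cV[R]_d -> R) (hE : twice_continuously_differentiable E)
    (F : 'cV[R]_d -> 'cV[R]_d) (hF : F = fun x => - grad E x)
    (J : 'cV[R]_d -> 'M[R]_d) (hJ : J = fun x => - hessian E x)
    (L : R) (hL : 0 < L) (hA : lipschitz_linear_growth L F J)
    (T beta gamma : R) (hT : 0 < T) (hbeta : 0 < beta) (hgamma : 0 < gamma)
    (x0 : 'cV[R]_d) (v0 : 'I_k -> 'cV[R]_d) (hv0 : orthonormal_family v0)
    (x : R -> 'cV[R]_d) (v : 'I_k -> R -> 'cV[R]_d)
    (hxv : HiSD_solution F J T beta gamma x0 v0 x v) :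
  exists tau0 Q : R, [/\ 0 < tau0, 0 < Q &
    forall (N : nat) (tau : R), (0 < N)%N -> tau = T / N%:R -> tau <= tau0 ->
    forall (xd : nat -> 'cV[R]_d) (vd : nat -> 'I_k -> 'cV[R]_d),
      HiSD_scheme F J tau beta gamma N x0 v0 xd vd ->
    forall n : nat, (1 <= n <= N)%N ->
      enorm (x (n%:R * tau) - xd n)
        + \sum_(i < k) enorm (v i (n%:R * tau) - vd n i) <= Q * tau].
Proof.
have [lipF lipJ] := lipschitz_max_norm (ltW hL) hA.
have J_sym y : (J y)^T = J y by rewrite hJ linearN /= hessian_sym.
have [h0 [Q [h0_gt0 Q0 conv]]] :=
  euler_convergence lipF lipJ J_sym (ltW hbeta) (ltW hT) hv0 hxv.
exists h0, (d%:R * Q + 1); split=> // [|N tau N0 tauE tau_h0 xd vd sch n /andP[_ nN]].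
  by rewrite ltr_wpDl // mulr_ge0.
have tau0 : 0 < tau by rewrite tauE divr_gt0 // ltr0n.
have NT : N%:R * tau <= T by rewrite tauE mulrC divfK // pnatr_eq0 -lt0n.
have := conv N tau _ NT xd vd sch n nN; rewrite (ltW tau0) tau_h0 => /(_ isT) err.
apply: (@le_trans _ _ (d%:R * (Q * tau))); last first.
  by rewrite mulrDl mul1r mulrA lerDl ltW.
apply: le_trans (ler_wpM2l (ler0n R d) err).
rewrite /state_dist /= mulrDr mulr_sumr lerD ?enorm_le_norm //.
by apply: ler_sum => i _; exact: enorm_le_norm.
Qed.
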